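(* Let $\mathcal{K}$ be a free amalgamation class in a countable relational language, let $\mathcal{M}$ be its Fraïssé limit with universe $M$, and let $G=\mathrm{Aut}(\mathcal{M})$. Then every group topology $\tau$ on $G$ with $\tau\subseteq\tau_{st}$ is of the form $\tau=\tau_{st}^{X}$ for some $G$-invariant set $X\subseteq M$. In particular, if the action of $G$ on $M$ is transitive, then $(G,\tau_{st})$ is totally minimal.
   Context: For relational structures $A\subseteq B,C$, the free amalgam $B\otimes_A C$ is the structure on the disjoint union of $B$ and $C$ over $A$ in which a relation holds exactly when it holds in $B$ or in $C$. A free amalgamation class is a class $\mathcal{K}$ of finite structures in a relational language, closed under isomorphism and substructures, such that $B\otimes_A C\in\mathcal{K}$ whenever $A,B,C\in\mathcal{K}$ with $A\subseteq B,C$ (such a class is a Fraïssé class). The Fraïssé limit is the unique countable ultrahomogeneous structure whose class of finite substructures (up to isomorphism) is $\mathcal{K}$. For a permutation group $G$ of a set $\Omega$ and $A\subseteq\Omega$, $G_A=\{g\in G: ga=a\ \forall a\in A\}$. For a $G$-invariant $X\subseteq\Omega$, $\tau_{st}^{X}$ is the group topology on $G$ having $\{G_A: A\subseteq X \text{ finite}\}$ as a base of neighbourhoods of the identity; $\tau_{st}=\tau_{st}^{\Omega}$ (so $\tau_{st}^{\emptyset}=\{\emptyset,G\}$). A Hausdorff topological group is totally minimal if every continuous surjective homomorphism from it onto a Hausdorff topological group is open. *)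

(* Defs.v *)
From HB Require Import structures.
From mathcomp Require Import all_boot.
From mathcomp Require Import all_classical topology.

Set Implicit Arguments.
Unset Strict Implicit.
Unset Printing Implicit Defensive.

Local Open Scope classical_set_scope.
Local Open Scope group_scope.

Record language := Language { symb :> Type ; arity : symb -> nat }.

Record structure (L : language) := Structure {
  carrier :> Type ;
  interp : forall R : L, set ((arity R).-tuple carrier)
}.
Arguments interp {L} s R.

Section Structures.
Context {L : language}.

Definition embedding (A B : structure L) (f : A -> B) : Prop :=
  injective f /\
  forall (R : L) (t : (arity R).-tuple A),
    interp B R (map_tuple f t) <-> interp A R t.

Definition isomorphism (A B : structure L) (f : A -> B) : Prop :=
  bijective f /\
  forall (R : L) (t : (arity R).-tuple A),
    interp B R (map_tuple f t) <-> interp A R t.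

Definition isomorphic (A B : structure L) : Prop :=
  exists f : A -> B, isomorphism f.

Definition substructure (M : structure L) (S : set M) : structure L :=
  @Structure L S (fun R t => interp M R (map_tuple val t)).

(* The inclusions of A in B and in C are replaced by embeddings i and j. The
   disjoint union over A is realised as B plus the part of C outside A, and
   [amalg_r] is the resulting map from all of C. *)
Section FreeAmalgam.
Variables (A B C : structure L) (i : A -> B) (j : A -> C).

Definition amalg_carrier : Type := (B + ~` range j)%type.

Definition amalg_l (b : B) : amalg_carrier := inl b.

Definition amalg_r (c : C) : amalg_carrier :=
  match pselect (range j c) with
  | left jc => inl (i (s2val (cid2 jc)))
  | right njc => inr (exist _ c (mem_set (njc : (~` range j) c)))
  end.

Definition free_amalgam : structure L := @Structure L amalg_carrier
  (fun R => (map_tuple amalg_l @` interp B R) `|` (map_tuple amalg_r @` interp C R)).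

Lemma amalg_lr : injective j -> forall a, amalg_r (j a) = amalg_l (i a).
Proof.
move=> jI a; rewrite /amalg_r /amalg_l; case: pselect => [p|]; last first.
  by case; exists a.
by case: cid2 => a' _ /= /jI ->.
Qed.

End FreeAmalgam.

(* Carriers may be empty. In particular free amalgams over the empty structure
   are required to be in the class. *)
Record free_amalgamation_class (K : structure L -> Prop) : Prop := {
  fac_finite : forall A : structure L, K A -> finite_set [set: A] ;
  fac_isomorphic : forall A B : structure L, isomorphic A B -> K A -> K B ;
  fac_substructure : forall (B : structure L) (S : set B),
    K B -> K (substructure S) ;
  fac_free_amalgam : forall (A B C : structure L) (i : A -> B) (j : A -> C),
    embedding i -> embedding j -> K A -> K B -> K C -> K (free_amalgam i j)
}.

Definition ultrahomogeneous (M : structure L) : Prop :=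
  forall (S T : set M) (f : substructure S -> substructure T),
    finite_set S -> finite_set T -> isomorphism f ->
    exists g : M -> M,
      isomorphism g /\ forall x : substructure S, g (val x) = val (f x).

Record fraisse_limit (K : structure L -> Prop) (M : structure L) : Prop := {
  fraisse_countable : countable [set: M] ;
  fraisse_ultrahomogeneous : ultrahomogeneous M ;
  fraisse_age : forall A : structure L,
    K A <-> exists2 S : set M, finite_set S & isomorphic A (substructure S)
}.

End Structures.

Record aut (L : language) (M : structure L) := Aut {
  aut_fun :> M -> M ;
  aut_iso : isomorphism aut_fun
}.

Section AutGroup.
Context {L : language} {M : structure L}.

HB.instance Definition _ := gen_eqMixin (aut M).
HB.instance Definition _ := gen_choiceMixin (aut M).

Lemma aut_eq (g h : aut M) : (forall x, g x = h x) -> g = h.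
Proof.
case: g h => [g gP] [h hP] /= /funext gh; subst h.
by congr Aut; exact: Prop_irrelevance.
Qed.

Lemma aut_one_iso : isomorphism (@id M).
Proof.
split=> [|R t]; first by exists id.
by rewrite (_ : map_tuple id t = t) //; apply: val_inj; rewrite /= map_id.
Qed.

Lemma aut_mul_iso (g h : aut M) : isomorphism (g \o h).
Proof.
split=> [|R t]; first exact: bij_comp (aut_iso g).1 (aut_iso h).1.
rewrite (_ : map_tuple _ t = map_tuple g (map_tuple h t)).
  by rewrite (aut_iso g).2 (aut_iso h).2.
by apply: val_inj; rewrite /= map_comp.
Qed.

Lemma aut_inv_ex (g : aut M) : exists h : aut M, cancel g h /\ cancel h g.
Proof.
have [[h gK hK] gR] := aut_iso g.
suff hP : isomorphism h by exists (Aut hP).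
split=> [|R t]; first by exists g.
rewrite -gR (_ : map_tuple g (map_tuple h t) = t) //.
by apply: val_inj; rewrite /= -map_comp -[RHS]map_id; exact: eq_map.
Qed.

Definition aut_one : aut M := Aut aut_one_iso.
Definition aut_mul (g h : aut M) : aut M := Aut (aut_mul_iso g h).
Definition aut_inv (g : aut M) : aut M := sval (cid (aut_inv_ex g)).

Lemma aut_invP (g : aut M) : cancel g (aut_inv g) /\ cancel (aut_inv g) g.
Proof. by rewrite /aut_inv; case: cid. Qed.

Lemma aut_mulA : associative aut_mul. Proof. by move=> *; exact: aut_eq. Qed.
Lemma aut_mul1 : left_id aut_one aut_mul. Proof. by move=> *; exact: aut_eq. Qed.
Lemma aut_mulr1 : right_id aut_one aut_mul.
Proof. by move=> *; exact: aut_eq. Qed.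
Lemma aut_mulV : left_inverse aut_one aut_inv aut_mul.
Proof. by move=> g; apply: aut_eq => x /=; rewrite (aut_invP g).1. Qed.
Lemma aut_mulrV : right_inverse aut_one aut_inv aut_mul.
Proof. by move=> g; apply: aut_eq => x /=; rewrite (aut_invP g).2. Qed.

HB.instance Definition _ := isGroup.Build (aut M)
  aut_mulA aut_mul1 aut_mulr1 aut_mulV aut_mulrV.

Lemma aut_mulE (g h : aut M) x : (g * h) x = g (h x). Proof. by []. Qed.

Definition pstab (A : set M) : set (aut M) :=
  [set g | forall a, A a -> g a = a].

Definition aut_invariant (X : set M) : Prop :=
  forall (g : aut M) x, X x -> X (g x).

Definition aut_transitive : Prop := forall x y : M, exists g : aut M, g x = y.

End AutGroup.
Arguments aut_transitive {L} M.

Record topology_on (T : Type) := TopologyOn {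
  opens : set_system T ;
  opensT : opens setT ;
  opensI : setI_closed opens ;
  opens_bigcup : forall F : set_system T,
    F `<=` opens -> opens (\bigcup_(U in F) U)
}.

(* Carrier alias: it lets one set T carry the library's topological notions for
   several topologies tau at the same time. *)
Definition space (T : Type) (tau : topology_on T) : Type := T.

Section Space.
Variables (T : Type) (tau : topology_on T).

Lemma opens_bigU (I : Type) (f : I -> set T) :
  (forall i, opens tau (f i)) -> opens tau (\bigcup_i f i).
Proof.
move=> fo; rewrite (_ : \bigcup_i f i = \bigcup_(U in range f) U).
  by apply: opens_bigcup => _ [i _ <-].
by rewrite bigcup_image.
Qed.

HB.instance Definition _ := gen_eqMixin (space tau).
HB.instance Definition _ := gen_choiceMixin (space tau).
HB.instance Definition _ :=
  isOpenTopological.Build (space tau) (opensT tau) (@opensI _ tau) opens_bigU.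

Lemma openE_space : @open (space tau) = opens tau. Proof. by []. Qed.

End Space.

(* Group topologies are not assumed to be Hausdorff. *)
Definition group_topology (G : groupType) (tau : topology_on G) : Prop :=
  continuous
    (fun p : space tau * space tau => (p.1 : G) * (p.2 : G) : space tau) /\
  continuous (fun x : space tau => (x : G)^-1 : space tau).

Definition totally_minimal (G : groupType) (tau : topology_on G) : Prop :=
  [/\ group_topology tau,
      hausdorff_space (space tau) &
      forall (H : groupType) (sigma : topology_on H) (f : G -> H),
        group_topology sigma -> hausdorff_space (space sigma) ->
        {morph f : x y / x * y} -> set_surj [set: G] [set: H] f ->
        continuous (f : space tau -> space sigma) ->
        forall U : set (space tau),
          open U -> open (f @` U : set (space sigma))].

Section StandardTopology.
Context {L : language} {M : structure L}.

(* U is open when, for every g in U, it contains a coset g G_A for some finite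
   A in X; [tau_st_nbhs1] and [tau_st_group] show that for invariant X this is
   the group topology in which the G_A form a base of neighbourhoods of 1. *)
Definition tau_st_open (X : set M) : set_system (aut M) :=
  [set U | forall g, U g -> exists A : set M,
     [/\ finite_set A, A `<=` X & forall h, pstab A h -> U (g * h)]].

Lemma tau_st_openT X : tau_st_open X setT.
Proof. by move=> g _; exists set0; split. Qed.

Lemma tau_st_openI X : setI_closed (tau_st_open X).
Proof.
move=> U V Uo Vo g [/Uo[A [Af AX AU]] /Vo[B [Bf BX BV]]].
exists (A `|` B); split; first by rewrite finite_setU.
  by move=> x [/AX|/BX].
move=> h hAB; split; [apply: AU|apply: BV] => a Aa; apply: hAB; [left|right];
  exact: Aa.
Qed.

Lemma tau_st_open_bigcup X (F : set_system (aut M)) :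
  F `<=` tau_st_open X -> tau_st_open X (\bigcup_(U in F) U).
Proof.
move=> FX g [U FU Ug]; have [A [Af AX AU]] := FX _ FU _ Ug.
by exists A; split=> // h /AU ?; exists U.
Qed.

Definition tau_st (X : set M) : topology_on (aut M) :=
  TopologyOn (@tau_st_openT X) (@tau_st_openI X) (@tau_st_open_bigcup X).

Lemma pstab_open (X A : set M) (g : aut M) : finite_set A -> A `<=` X ->
  opens (tau_st X) [set h | pstab A (g^-1 * h)].
Proof.
move=> Af AX h ghA; exists A; split=> // k kA a Aa.
by rewrite mulgA aut_mulE kA // ghA.
Qed.

Lemma tau_st_nbhs1 (X : set M) (U : set (space (tau_st X))) :
  nbhs ((1 : aut M) : space (tau_st X)) U <->
  exists A : set M, [/\ finite_set A, A `<=` X & pstab A `<=` U].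
Proof.
split=> [[V [Vo V1 VU]]|[A [Af AX AU]]].
  have [A [Af AX AV]] := Vo _ V1.
  by exists A; split=> // h /AV; rewrite mul1g => /VU.
exists [set h | pstab A (1^-1 * h)]; split; first exact: pstab_open.
  by rewrite /= mulVg.
by move=> h /=; rewrite invg1 mul1g => /AU.
Qed.

Lemma tau_st_group (X : set M) : aut_invariant X -> group_topology (tau_st X).
Proof.
move=> Xinv; split; apply/continuousP => U Uo /=.
  rewrite openE => -[g h] /= Ugh; have [A [Af AX AU]] := Uo _ Ugh.
  exists ([set k | pstab (h @` A) (g^-1 * k)], [set k | pstab A (h^-1 * k)]).
    split=> /=; [exists [set k | pstab (h @` A) (g^-1 * k)]
                |exists [set k | pstab A (h^-1 * k)]]; split=> //=.
    - apply: pstab_open; first exact: finite_image.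
      by move=> _ [a /AX aX <-]; exact: Xinv.
    - by move=> a _; rewrite mulVg.
    - exact: pstab_open.
    - by move=> a _; rewrite mulVg.
  move=> [k l] /= [kA lA]; suff /AU : pstab A ((g * h)^-1 * (k * l)).
    by rewrite mulVKg.
  move=> a Aa.
  have hl : h a = l a by rewrite -[in LHS](lA a Aa) -aut_mulE mulVKg.
  have gk : (g^-1 * k) (h a) = h a by apply: kA; exists a.
  have -> : (g * h)^-1 * (k * l) = h^-1 * (g^-1 * k) * l.
    by rewrite invgM !mulgA.
  by rewrite 2!aut_mulE -hl gk -aut_mulE mulVg.
rewrite openE => g /= Ug; have [A [Af AX AU]] := Uo _ Ug.
exists [set k | pstab ((g^-1 : aut M)%g @` A) (g^-1 * k)]; split.
- apply: pstab_open; first exact: finite_image.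
  by move=> _ [a /AX aX <-]; exact: Xinv.
- by move=> a _; rewrite mulVg.
move=> k /= kA; suff /AU : pstab A (g * k^-1) by rewrite mulKg.
move=> a Aa; have gk : (g^-1 * k) (g^-1 a) = g^-1 a by apply: kA; exists a.
have kg : k (g^-1 a) = a by rewrite -(mulVKg g k) aut_mulE gk -aut_mulE mulgV.
have ka : k^-1 a = g^-1 a by rewrite -[in LHS]kg -aut_mulE mulVg.
by rewrite aut_mulE ka -aut_mulE mulgV.
Qed.

End StandardTopology.

(* Main.v *)
(* Let X be the set of points a whose stabiliser G_a is a tau-neighbourhood of 1.
   Every tau-neighbourhood V of 1 contains G_A for some finite A. Points outside
   X have infinite orbits under V, so a topological form of Neumann's covering
   lemma gives g in V with g(A minus X) disjoint from A, hence A `&` gA is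
   contained in X. Free amalgamation provides generic copies of A and gA over
   each other, and composing through them shows that the pointwise stabiliser of
   A `&` gA is contained in a product of boundedly many copies of G_A and G_gA,
   hence in a fixed power of V. So tau is generated by the G_a with a in X.
   For total minimality, apply this to the pullback of the topology of the
   target: by transitivity X is empty or everything. *)
Require Import Defs.
From mathcomp Require Import all_boot.
From mathcomp Require Import all_classical topology.
Set Implicit Arguments.
Unset Strict Implicit.
Unset Printing Implicit Defensive.

Local Open Scope classical_set_scope.
Local Open Scope group_scope.

(** * Neighbourhoods of the identity in a group topology *)

Section GroupTopology.
Context {G : groupType}.

(** Rewrites continuity on the product space through open rectangles, so that later arguments work
    with [opens tau] on [G] itself. *)
Lemma group_topologyP (tau : topology_on G) : group_topology tau <->
  (forall U, opens tau U -> forall x y, U (x * y) -> exists P Q : set G,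
     [/\ opens tau P, opens tau Q, P x, Q y & forall p q, P p -> Q q -> U (p * q)]) /\
  (forall U, opens tau U -> opens tau [set x | U x^-1]).
Proof.
split=> [[/continuousP mulc /continuousP invc]|[mulc invc]]; split.
- move=> U Uo x y Uxy; have := mulc U Uo; rewrite openE => /(_ (x, y) Uxy).
  case=> -[P0 Q0] /= [[P [Po Px PP]] [Q [Qo Qy QQ]]] PQU.
  exists P, Q; split=> // p q Pp Qq.
  by have /= := PQU (p, q); apply; split; [exact: PP|exact: QQ].
- by move=> U Uo; exact: (invc U Uo).
- apply/continuousP => U Uo; rewrite openE => -[x y] /= Uxy.
  have [P [Q [Po Qo Px Qy PQ]]] := mulc U Uo x y Uxy.
  exists (P, Q); first by (split; [exists P; split|exists Q; split]).
  by move=> [p q] /= [Pp Qq]; exact: PQ.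
- by apply/continuousP => U Uo; exact: (invc U Uo).
Qed.

Context {tau : topology_on G} (tau_gt : group_topology tau).

Lemma opensP (U : set G) :
  (forall x, U x -> exists V, [/\ opens tau V, V x & V `<=` U]) -> opens tau U.
Proof.
move=> UV; rewrite -[opens tau U]/(open (U : set (space tau))) openE => x /UV.
by move=> [V [Vo Vx VU]]; exists V.
Qed.

Lemma opens_mul U x y : opens tau U -> U (x * y) -> exists P Q : set G,
  [/\ opens tau P, opens tau Q, P x, Q y & forall p q, P p -> Q q -> U (p * q)].
Proof. by move=> Uo; exact: ((group_topologyP tau).1 tau_gt).1. Qed.

Lemma opens_inv U : opens tau U -> opens tau [set x | U x^-1].
Proof. exact: ((group_topologyP tau).1 tau_gt).2. Qed.

Lemma opens_mull U g : opens tau U -> opens tau [set x | U (g * x)].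
Proof.
move=> Uo; apply: opensP => x /= /(opens_mul Uo)[P [Q [Po Qo Pg Qx PQ]]].
by exists Q; split=> // q; exact: PQ.
Qed.

Lemma opens_mulr U g : opens tau U -> opens tau [set x | U (x * g)].
Proof.
move=> Uo; apply: opensP => x /= /(opens_mul Uo)[P [Q [Po Qo Px Qg PQ]]].
by exists P; split=> // q /PQ; exact.
Qed.

Definition nbhd1 (U : set G) := exists V, [/\ opens tau V, V 1 & V `<=` U].

Lemma nbhd1_sub U W : U `<=` W -> nbhd1 U -> nbhd1 W.
Proof. by move=> UW [V [Vo V1 /subset_trans VU]]; exists V; split=> //; exact: VU. Qed.

Lemma nbhd1_setI U W : nbhd1 U -> nbhd1 W -> nbhd1 (U `&` W).
Proof.
move=> [V [Vo V1 VU]] [V' [V'o V'1 V'W]]; exists (V `&` V'); split=> //.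
  exact: opensI.
exact: setISS.
Qed.

Lemma nbhd1_one U : nbhd1 U -> U 1. Proof. by move=> [V [_ V1 VU]]; exact: VU. Qed.

Lemma nbhd1_conj g U : nbhd1 U -> nbhd1 [set x | U (g^-1 * x * g)].
Proof.
move=> [V [Vo V1 VU]]; exists [set x | V (g^-1 * (x * g))]; split.
- exact: (opens_mulr g (opens_mull g^-1 Vo)).
- by rewrite /= mul1g mulVg.
- by move=> x /VU; rewrite /= mulgA.
Qed.

Lemma nbhd1_half U : nbhd1 U -> exists V,
  [/\ nbhd1 V, forall x, V x -> V x^-1 & forall x y, V x -> V y -> U (x * y)].
Proof.
move=> [W [Wo W1 WU]]; have [|P [Q [Po Qo P1 Q1 PQ]]] := @opens_mul W 1 1 Wo.
  by rewrite mul1g.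
pose V := P `&` Q; have Vo : opens tau V by exact: opensI.
exists (V `&` [set x | V x^-1]); split=> [|x [Vx Vx']|x y [[Px _] _] [[_ Qy] _]].
- exists (V `&` [set x | V x^-1]); split=> //.
    by apply: opensI => //; exact: opens_inv.
  by rewrite /V /= invg1.
- by split; rewrite //= invgK.
- by apply: WU; exact: PQ.
Qed.

(** Together with [opens_nbhd1]: by left translation, the neighbourhoods of 1 determine a group
    topology. *)
Lemma nbhd1_opens U x : opens tau U -> U x -> nbhd1 [set h | U (x * h)].
Proof.
move=> Uo Ux; exists [set h | U (x * h)].
by split; [exact: opens_mull|rewrite /= mulg1|].
Qed.

Lemma opens_nbhd1 U : (forall x, U x -> nbhd1 [set h | U (x * h)]) -> opens tau U.
Proof.
move=> UV; apply: opensP => x /UV[V [Vo V1 VU]].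
exists [set y | V (x^-1 * y)]; split; first exact: opens_mull.
  by rewrite /= mulVg.
by move=> y /VU; rewrite /= mulVKg.
Qed.

End GroupTopology.
Arguments nbhd1 {G} tau U.

Lemma topology_on_eq (T : Type) (sigma tau : topology_on T) :
  (forall U, opens sigma U <-> opens tau U) -> sigma = tau.
Proof.
case: sigma tau => [o1 a1 b1 c1] [o2 a2 b2 c2] /= o12.
have E : o1 = o2 by apply/funext => U; apply/propext.
by subst o2; congr TopologyOn; exact: Prop_irrelevance.
Qed.

Lemma map_tuple_id_in (T : Type) n (h : T -> T) (t : n.-tuple T) :
  (forall i, h (tnth t i) = tnth t i) -> map_tuple h t = t.
Proof. by move=> ht; apply: eq_from_tnth => i; rewrite tnth_map ht. Qed.

Lemma eq_map_tuple (T U : Type) n (f g : T -> U) (t : n.-tuple T) :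
  (forall i, f (tnth t i) = g (tnth t i)) -> map_tuple f t = map_tuple g t.
Proof. by move=> fg; apply: eq_from_tnth => i; rewrite !tnth_map fg. Qed.

Lemma map_tuple_inj (T U : Type) n (f : T -> U) :
  injective f -> injective (map_tuple f : n.-tuple T -> n.-tuple U).
Proof.
move=> fI s t st; apply: eq_from_tnth => k; apply: fI.
by have := congr1 (fun v => tnth v k) st; rewrite !tnth_map.
Qed.

Lemma lift_tuple (T : Type) (S : set T) n (t : n.-tuple T) :
  (forall i, S (tnth t i)) -> exists s : n.-tuple S, t = map_tuple val s.
Proof.
move=> tS; exists [tuple SigSub (mem_set (tS i)) | i < n].
by apply: eq_from_tnth => i; rewrite tnth_map tnth_mktuple.
Qed.

(** * Finite partial automorphisms and free independence *)

Section Homogeneous.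
Context {L : language} {M : structure L}.
Hypothesis M_uh : ultrahomogeneous M.

Lemma aut_interp (g : aut M) (R : L) (t : (arity R).-tuple M) :
  interp M R (map_tuple g t) <-> interp M R t.
Proof. exact: (aut_iso g).2. Qed.

Lemma aut_inj (g : aut M) : injective g.
Proof. exact: bij_inj (aut_iso g).1. Qed.

Lemma autK (g : aut M) : cancel g (g^-1)%g.
Proof. exact: (aut_invP g).1. Qed.

Lemma autKV (g : aut M) : cancel (g^-1)%g g.
Proof. exact: (aut_invP g).2. Qed.

(** [phi] is total so that maps can be glued by case distinction; only its restriction to [S]
    matters, and ultrahomogeneity applies to the isomorphism it induces from [S] onto its image. *)
Lemma extend_partial (S : set M) (phi : M -> M) : finite_set S ->
  (forall x y, S x -> S y -> phi x = phi y -> x = y) ->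
  (forall R (t : (arity R).-tuple M), (forall i, S (tnth t i)) ->
     interp M R (map_tuple phi t) <-> interp M R t) ->
  exists g : aut M, forall x, S x -> g x = phi x.
Proof.
move=> Sf phiI phiR.
have phiS (x : S) : (phi @` S) (phi (val x)) by exists (val x) => //; exact: set_valP.
pose f (x : substructure S) : substructure (phi @` S) := SigSub (mem_set (phiS x)).
have f_iso : isomorphism f.
  split.
    have fI : injective f.
      move=> x y /(congr1 val) /= /phiI xy; apply: val_inj; apply: xy; exact: set_valP.
    have fS y : exists x, f x = y.
      have [x Sx xy] := set_valP y.
      by exists (SigSub (mem_set Sx)); apply: val_inj.
    have [g gK] := choice fS.
    by exists g => // x; apply: fI.
  move=> R t; rewrite /= -(phiR R (map_tuple val t)); last first.
    by move=> i; rewrite tnth_map; exact: set_valP.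
  rewrite (_ : map_tuple val (map_tuple f t) = map_tuple phi (map_tuple val t)) //.
  by apply: eq_from_tnth => i; rewrite !tnth_map.
have [g [g_iso gf]] := M_uh Sf (finite_image phi Sf) f_iso.
by exists (Aut g_iso) => x Sx; exact: (gf (SigSub (mem_set Sx))).
Qed.

Lemma extend_embedding (D : set M) (f : substructure D -> M) : finite_set D ->
  embedding f -> exists g : aut M, forall x : D, g (val x) = f x.
Proof.
move=> Df [fI fR].
have [phi phiE] : exists phi : M -> M, forall x : D, phi (val x) = f x.
  (* Off [D] the value is arbitrary; quantifying over the proof of membership lets choice produce a
     total extension of [f]. *)
  have /choice[phi phiE] (x : M) : exists y, forall Dx : x \in D, y = f (SigSub Dx).
    have [Dx|nDx] := pselect (x \in D); last by exists x => Dx; have := nDx Dx.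
    by exists (f (SigSub Dx)) => Dx'; congr f; apply: val_inj.
  by exists phi => -[x Dx]; exact: phiE.
have [x y Dx Dy|R t tD|g gE] := extend_partial (phi := phi) Df.
- have := phiE (SigSub (mem_set Dx)); have := phiE (SigSub (mem_set Dy)).
  by move=> /= -> -> /fI /(congr1 val).
- have [s ->] := lift_tuple tD; rewrite -[X in _ <-> X]fR.
  rewrite (_ : map_tuple phi _ = map_tuple f s) //.
  by apply: eq_from_tnth => k; rewrite !tnth_map phiE.
by exists g => x; rewrite gE ?phiE //; exact: set_valP.
Qed.

(* This expresses that A `|` B is the free amalgam of A and B over A `&` B. *)
Definition indep (A B : set M) := forall R (t : (arity R).-tuple M),
  interp M R t -> (forall i, (A `|` B) (tnth t i)) ->
  (forall i, A (tnth t i)) \/ (forall i, B (tnth t i)).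

Lemma indep_aut (g : aut M) (A B : set M) :
  indep A B -> indep (g @` A) (g @` B).
Proof.
move=> AB R t Rt tAB.
have tE : t = map_tuple g (map_tuple (g^-1 : aut M)%g t).
  by apply: eq_from_tnth => i; rewrite !tnth_map autKV.
have [|i|sA|sB] := AB R (map_tuple (g^-1 : aut M)%g t).
- by rewrite -(aut_interp g) -tE.
- by rewrite tnth_map; case: (tAB i) => -[x ? <-]; rewrite autK; [left|right].
- left=> i; move: (sA i); rewrite tnth_map => sAi.
  by exists (g^-1 (tnth t i)); rewrite ?autKV.
- right=> i; move: (sB i); rewrite tnth_map => sBi.
  by exists (g^-1 (tnth t i)); rewrite ?autKV.
Qed.

(** The union of [f] on [A] and the identity on [P] is a partial isomorphism: the last two
    hypotheses make it well defined and injective, and independence before and after the map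
    prevents a relation from mixing the two pieces. *)
Lemma indep_glue (f : aut M) (A P : set M) :
  finite_set A -> finite_set P -> indep A P -> indep (f @` A) P ->
  (forall a, A a -> P a -> f a = a) -> (forall a, A a -> P (f a) -> P a) ->
  exists k : aut M, pstab P k /\ forall a, A a -> k a = f a.
Proof.
move=> Af Pf AP fAP fid fP; pose phi x := if pselect (A x) then f x else x.
have phiA x : A x -> phi x = f x by rewrite /phi; case: pselect.
have phiP x : P x -> phi x = x.
  by move=> Px; rewrite /phi; case: pselect => // Ax; rewrite fid.
have [|x y [Ax|Px] [Ay|Py]|R t tS|k kphi] := @extend_partial (A `|` P) phi.
- by rewrite finite_setU.
- by rewrite !phiA // => /aut_inj.
- rewrite phiA // phiP // => fxy.
  by rewrite -fxy fid //; apply: fP; rewrite ?fxy.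
- rewrite phiP // phiA // => fxy.
  by rewrite fxy fid //; apply: fP; rewrite -?fxy.
- by rewrite !phiP.
- have At : (forall i, A (tnth t i)) -> map_tuple phi t = map_tuple f t.
    by move=> tA; apply: eq_map_tuple => i; exact: phiA.
  have Pt : (forall i, P (tnth t i)) -> map_tuple phi t = t.
    by move=> tP; apply: map_tuple_id_in => i; exact: phiP.
  split=> [Rt|Rt].
    have [i|tA|tP] := fAP R _ Rt.
    + rewrite tnth_map; case: (tS i) => [?|tP].
        by left; rewrite phiA //; exists (tnth t i).
      by right; rewrite phiP.
    (* An entry of [t] in [P] is its own image, hence some [f a]; then [a] is in [P], so [f a = a]
       and the entry is in [A]. *)
    + have {}tA i : A (tnth t i).
        case: (tS i) => // tP; move: (tA i); rewrite tnth_map phiP // => -[a Aa fa].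
        suff -> : tnth t i = a by [].
        by rewrite -fa fid //; apply: fP; rewrite // fa.
      by rewrite -(aut_interp f) -At.
    + rewrite -Pt // => i; case: (tS i) => // tA.
      by move: (tP i); rewrite tnth_map phiA //; exact: fP.
  have [//|tA|tP] := AP R t Rt.
    by rewrite At // aut_interp.
  by rewrite Pt.
exists k; split=> a ?; rewrite kphi; [exact: phiP|by right|exact: phiA|by left].
Qed.

End Homogeneous.

(** * The two legs of a free amalgam *)

Section Amalgam.
Context {L : language} {A B C : structure L} (i : A -> B) (j : A -> C).
Hypotheses (i_emb : embedding i) (j_emb : embedding j).

Lemma amalg_r_eq_l (c : C) (b : B) :
  amalg_r i j c = amalg_l j b -> exists2 a, j a = c & i a = b.
Proof.
rewrite /amalg_r /amalg_l; case: pselect => // jc [].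
by case: cid2 => a _ /= ac ab; exists a.
Qed.

Lemma amalg_r_inj : injective (amalg_r i j).
Proof.
move=> x y; rewrite /amalg_r; case: pselect => [jx|nx]; case: pselect => [jy|ny] //.
  by case: cid2 => a ? ax; case: cid2 => b ? bx [] /i_emb.1 ab; rewrite -ax -bx ab.
by case.
Qed.

(** The legs meet only in [A], so a relation that one leg imposes on the other already holds in [A];
    this makes both legs embeddings. *)
Lemma amalg_tuple n (s : n.-tuple C) (t : n.-tuple B) :
  map_tuple (amalg_r i j) s = map_tuple (amalg_l j) t ->
  exists2 u : n.-tuple A, s = map_tuple j u & t = map_tuple i u.
Proof.
move=> st.
have /choice[u uP] k : exists a, j a = tnth s k /\ i a = tnth t k.
  have := congr1 (fun v => tnth v k) st; rewrite !tnth_map => /amalg_r_eq_l[a].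
  by exists a.
by exists [tuple u k | k < n]; apply: eq_from_tnth => k; rewrite tnth_map tnth_mktuple;
  have [] := uP k.
Qed.

Lemma amalg_l_embedding : embedding (amalg_l j : B -> free_amalgam i j).
Proof.
have lI : injective (amalg_l j : B -> free_amalgam i j) by move=> x y [].
split=> // R t; split=> [[[s Rs /(map_tuple_inj lI) <-//]|[s Rs st]]|Rt].
  have [u su ->] := amalg_tuple st.
  by rewrite i_emb.2 -j_emb.2 -su.
by left; exists t.
Qed.

Lemma amalg_r_embedding : embedding (amalg_r i j : C -> free_amalgam i j).
Proof.
split=> [|R t]; first exact: amalg_r_inj.
split=> [[[s Rs st]|[s Rs /(map_tuple_inj amalg_r_inj) <-//]]|Rt].
  have [u -> su] := amalg_tuple (esym st).
  by rewrite j_emb.2 -i_emb.2 -su.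
by right; exists t.
Qed.

End Amalgam.

(** * Free copies and factorisation of stabilisers *)

Section FreeLimit.
Context {L : language} {K : structure L -> Prop} {M : structure L}.
Hypothesis K_free : free_amalgamation_class K.
Hypothesis M_lim : fraisse_limit K M.

Let M_uh : ultrahomogeneous M := fraisse_ultrahomogeneous M_lim.

(** Amalgamate [D] with itself over [A] and realise the amalgam inside [M] via the age.
    Ultrahomogeneity extends the two legs to automorphisms [gl] and [gr], and applying [gl^-1] puts
    the left leg back on [D]. *)
Lemma free_copy (A D : set M) : finite_set D -> A `<=` D ->
  exists h : aut M, [/\ pstab A h,
    forall x, D x -> D (h x) -> A x & indep D (h @` D)].
Proof.
move=> Df AD; have Af : finite_set A := sub_finite_set AD Df.
have K_sub (S : set M) : finite_set S -> K (substructure S).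
  move=> Sf; apply/(fraisse_age M_lim); exists S => //; exists id; split.
    by exists id.
  by move=> R t; rewrite (_ : map_tuple id t = t) //; exact: map_tuple_id_in.
have iD (a : A) : val a \in D by apply/mem_set/AD; exact: set_valP.
pose i (a : substructure A) : substructure D := SigSub (iD a).
have i_emb : embedding i.
  split=> [x y /(congr1 val) /= xy|R t]; first exact: val_inj.
  rewrite /= (_ : map_tuple val (map_tuple i t) = map_tuple val t) //.
  by apply: eq_from_tnth => j; rewrite !tnth_map.
have := fac_free_amalgam K_free i_emb i_emb (K_sub _ Af) (K_sub _ Df) (K_sub _ Df).
case/(fraisse_age M_lim) => S Sf [e [e_bij e_R]].
have [lI lR] := amalg_l_embedding i_emb i_emb.
have [rI rR] := amalg_r_embedding i_emb i_emb.
pose l (x : substructure D) : free_amalgam i i := amalg_l i x.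
pose r (x : substructure D) : free_amalgam i i := amalg_r i i x.
have embE (f : substructure D -> free_amalgam i i) : embedding f ->
    exists g : aut M, forall x : D, g (val x) = val (e (f x)).
  move=> [fI fR]; apply: (@extend_embedding _ _ M_uh D (fun x => val (e (f x))) Df).
  split=> [x y /val_inj /(bij_inj e_bij) /fI //|R t].
  rewrite -fR -e_R /= (_ : map_tuple _ t = map_tuple val (map_tuple e (map_tuple f t))) //.
  by apply: eq_from_tnth => k; rewrite !tnth_map.
have [gl glE] := embE l (conj lI lR).
have [gr grE] := embE r (conj rI rR).
have glD x (Dx : D x) : gl x = val (e (l (SigSub (mem_set Dx)))) by rewrite -glE.
have grD x (Dx : D x) : gr x = val (e (r (SigSub (mem_set Dx)))) by rewrite -grE.
exists (gl^-1 * gr); split.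
- move=> a Aa; rewrite aut_mulE (grD _ (AD _ Aa)).
  suff -> : r (SigSub (mem_set (AD _ Aa))) = l (SigSub (mem_set (AD _ Aa))).
    by rewrite -glE autK.
  have -> : SigSub (mem_set (AD _ Aa)) = i (SigSub (mem_set Aa)) by exact: val_inj.
  exact: amalg_lr i_emb.1 _.
- move=> x Dx; rewrite aut_mulE => Dy.
  have := etrans (esym (grD _ Dx)) (etrans (esym (autKV gl (gr x))) (glD _ Dy)).
  move=> /val_inj /(bij_inj e_bij) /amalg_r_eq_l[a /(congr1 val) /= ax _].
  have : A (val a) by exact: set_valP.
  by rewrite (_ : val a = x).
(* [gl] moves the tuple into [S], the copy of the amalgam, where every relation comes from one of
   the legs. *)
- move=> R t Rt tD.
  have tS k : S (gl (tnth t k)).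
    case: (tD k) => [Dx|[x Dx <-]].
      rewrite (glD _ Dx); exact: set_valP.
    rewrite aut_mulE autKV (grD _ Dx); exact: set_valP.
  have : interp M R (map_tuple gl t) by rewrite aut_interp.
  have [|s st] := lift_tuple (S := S) (t := map_tuple gl t).
    by move=> k; rewrite tnth_map.
  have [e' eK e'K] := e_bij.
  have sE : s = map_tuple e (map_tuple e' s).
    by apply: eq_from_tnth => k; rewrite !tnth_map e'K.
  have stk k : gl (tnth t k) = val (tnth s k).
    by have := congr1 (fun v => tnth v k) st; rewrite !tnth_map.
  rewrite st -[interp M _ _]/(interp (substructure S) R s) sE e_R => -[] [u _ us].
    left=> k; have := stk k; rewrite sE -us !tnth_map -/(l _) -glE => /aut_inj ->.
    exact: set_valP.
  right=> k; exists (val (tnth u k)); first exact: set_valP.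
  have := stk k; rewrite sE -us !tnth_map -/(r _) -grE aut_mulE => <-.
  by rewrite autK.
Qed.


(** Let [l * h] carry [B] to a copy [Q] free from both [B] and its image under [f]. Then some [k]
    fixes [Q] and agrees with [f] on [B]: it is the conjugate by [l * h] of an element fixing [B],
    and [k^-1 * f] fixes [B]. *)
Lemma pstab_factor (A B : set M) (f : aut M) :
  finite_set A -> finite_set B -> pstab (A `&` B) f ->
  exists h l m n : aut M,
    [/\ pstab A h, pstab B l, pstab B m, pstab B n & f = l * h * m * h^-1 * n].
Proof.
move=> Af Bf fC; pose D := A `|` B.
have [|x Ax|h [hA hD D_hD]] := @free_copy A D; [by rewrite finite_setU|by left|].
pose P := h @` B.
have B_P : B `&` P `<=` A `&` B.
  move=> y [By [x Bx hx]]; have Ax : A x by apply: hD; right; rewrite ?hx.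
  by rewrite -hx hA.
have BiP : indep B P.
  move=> R t Rt tBP; have [i|tD|thD] := D_hD R t Rt.
  - by case: (tBP i) => [?|[x ? <-]]; [left; right|right; exists x => //; right].
  - left=> i; case: (tBP i) => // -[x Bx hx]; have Ax : A x.
      by apply: hD; [right|rewrite hx].
    by rewrite -hx hA.
  - right=> i; case: (tBP i) => // Bt; have [x Dx hx] := thD i.
    have Ax : A x by apply: hD => //; rewrite hx; right.
    by exists (tnth t i) => //; rewrite -hx hA // hA.
(* [P] is free from [B] but may be related to the image of [B] under [f]; a second free copy, over
   [B], removes these relations. *)
pose E := B `|` P `|` f @` B.
have Ef : finite_set E by rewrite !finite_setU; do !split; try exact: finite_image.
have [|l [lB lE E_lE]] := free_copy Ef (A := B); first by move=> x Bx; left; left.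
pose Q := l @` P.
have Qf : finite_set Q by do 2!apply: finite_image.
have E_P x : P x -> E x by move=> Px; left; right.
(* Points of [Q] inside [E] lie in both [A] and [B], where [h], [l] and [f] are all the identity. *)
have Q_E x : P x -> E (l x) -> (A `&` B) x /\ l x = x.
  move=> Px lEx; have Bx : B x by apply: lE => //; exact: E_P.
  by split; [exact: B_P|exact: lB].
have BiQ : indep B Q.
  rewrite (_ : B = l @` B); first exact: indep_aut.
  by apply/seteqP; split=> [x Bx|_ [x Bx <-]]; [exists x; rewrite ?lB|rewrite lB].
have fBiQ : indep (f @` B) Q.
  move=> R t Rt tfBQ.
  have fB_of_B : (forall i, B (tnth t i)) -> forall i, (f @` B) (tnth t i).
    move=> tB i; case: (tfBQ i) => // -[x Px lx].
    have [|Cx lxx] := Q_E x Px; first by rewrite lx; left; left.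
    by exists x; [exact: Cx.2|rewrite -lx lxx fC].
  have [i|tE|tlE] := E_lE R t Rt.
  - by case: (tfBQ i) => [?|[x Px <-]]; [left; right|right; exists x => //; exact: E_P].
  - left=> i; case: (tfBQ i) => // -[x Px lx].
    have [|Cx lxx] := Q_E x Px; first by rewrite lx.
    by exists x; [exact: Cx.2|rewrite -lx lxx fC].
  (* Entries from the image of [B] under [f] lie in [E] and in its copy, hence in [B], so the
     independence of [B] and [Q] applies. *)
  - have [i|tB|tQ] := BiQ R t Rt; last by right.
      case: (tfBQ i) => [fBt|]; last by right.
      have [x Ex lx] := tlE i.
      have Bx : B x by apply: lE => //; rewrite lx; right.
      by left; rewrite -lx lB.
    by left; exact: fB_of_B.
have [a Ba [x Px lx]|a Ba [x Px lx]|k [kQ kf]] := indep_glue M_uh (f := f) Bf Qf BiQ fBiQ.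
- have [|Cx lxx] := Q_E x Px; first by rewrite lx; left; left.
  by rewrite -lx lxx fC.
- have [|Cx lxx] := Q_E x Px; first by rewrite lx; right; exists a.
  have <- : x = a by apply: (@aut_inj _ _ f); rewrite fC // -lx.
  by exists x.
(* The third witness fixes [B] because [k] fixes [Q]; the last one absorbs the [l^-1] left over from
   the conjugation. *)
exists h, l, ((l * h)^-1 * k * (l * h)), (l^-1 * (k^-1 * f)); split=> //.
- move=> x Bx; rewrite !aut_mulE kQ; last by exists (h x) => //; exists x.
  exact: (autK (l * h)).
- move=> x Bx; rewrite 2!aut_mulE -kf // autK.
  by rewrite -[in LHS](lB x Bx) autK.
- by rewrite invgM !mulgA !(mulgK, mulgVK, mulgV, mul1g).
Qed.

End FreeLimit.

Lemma finite_set_induction (T : Type) (P : set T -> Prop) :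
  P set0 -> (forall x A, P A -> P (x |` A)) -> forall A, finite_set A -> P A.
Proof.
move=> P0 PU A; elim/Pchoice: T => T in P P0 PU A *.
move=> /finite_seqP[s ->]; elim: s => [|x s IHs]; first by rewrite set_nil.
have -> : [set` x :: s] = x |` [set` s].
  by apply/seteqP; split=> y /=; rewrite in_cons => xs; exact/predU1P.
exact: PU.
Qed.

(** * Group topologies coarser than the standard one *)

Section CoarserTopology.
Context {L : language} {K : structure L -> Prop} {M : structure L}.
Hypothesis K_free : free_amalgamation_class K.
Hypothesis M_lim : fraisse_limit K M.
Context {tau : topology_on (aut M)} (tau_gt : group_topology tau).
Hypothesis tau_coarse : opens tau `<=` opens (tau_st [set: M]).

Definition open_points : set M := [set a | nbhd1 tau (pstab [set a])].

(** Conjugation by [g] carries the stabiliser of [a] to that of [g a]. *)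
Lemma open_points_invariant : aut_invariant open_points.
Proof.
move=> g a /(nbhd1_conj tau_gt g); apply: nbhd1_sub => h /= /(_ a erefl).
by rewrite 2!aut_mulE => /(congr1 g); rewrite autKV => hga _ ->.
Qed.

Lemma nbhd1_pstab U : nbhd1 tau U -> exists2 A : set M, finite_set A & pstab A `<=` U.
Proof.
move=> [V [/tau_coarse Vo V1 VU]]; have [A [Af _ AV]] := Vo _ V1.
by exists A => // h /AV; rewrite mul1g => /VU.
Qed.

Lemma pstab_nbhd1 A : finite_set A -> A `<=` open_points -> nbhd1 tau (pstab A).
Proof.
elim/finite_set_induction: A / => [_|x A IH xAX].
  by exists setT; split=> [||g _ a []] //; exact: opensT.
have [xX AX] : open_points x /\ A `<=` open_points.
  by split=> [|y Ay]; apply: xAX; [left|right].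
apply: nbhd1_sub (nbhd1_setI xX (IH AX)) => h [hx hA] y [->|Ay].
  exact: hx.
exact: hA.
Qed.

(* If [V a] lies in a finite set [T], pick [g] fixing [a] and moving [T] off
   itself outside [a]: then the intersection of [V] with its conjugate by [g]
   fixes [a]. *)
Lemma finite_orbit_open V a T : nbhd1 tau V -> finite_set T ->
  (forall v : aut M, V v -> T (v a)) -> open_points a.
Proof.
move=> Vn Tf VT.
have Ta : T a by exact: VT (nbhd1_one Vn).
have [|g [ga gT _]] := free_copy K_free M_lim Tf (A := [set a]).
  by move=> _ ->.
apply: nbhd1_sub (nbhd1_setI Vn (nbhd1_conj tau_gt g Vn)) => w [/VT Twa /VT].
have gVa : g^-1 a = a by rewrite -[in LHS](ga a erefl) autK.
rewrite 2!aut_mulE (ga a erefl) => Tgwa _ ->.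
have : g^-1 (w a) = a by apply: gT => //; rewrite autKV.
by move=> /(congr1 g); rewrite autKV ga.
Qed.

(** If every element of [O] sent [a] into [T], translating [O] back to 1 would contradict
    [finite_orbit_open]. *)
Lemma move_point O a T : opens tau O -> O !=set0 -> ~ open_points a ->
  finite_set T -> exists2 g, O g & ~ T (g a).
Proof.
move=> Oo [x Ox] aX Tf; apply: contrapT => noex; apply: aX.
apply: (finite_orbit_open (nbhd1_opens tau_gt Oo Ox) (finite_image (x^-1)%g Tf)).
move=> v Oxv; exists (x (v a)); last by rewrite autK.
by apply: contrapT => nT; apply: noex; exists (x * v).
Qed.

(* A topological version of B. H. Neumann's lemma on coverings by cosets. In the
   inductive step g' and g both send a to b and x moves a off b |` T2; choosing
   g' close to x keeps x * g'^-1 * g in O, and it agrees with x on a. *)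
Lemma move_finite S : finite_set S -> S `<=` ~` open_points ->
  forall T O, finite_set T -> opens tau O -> O !=set0 ->
  exists2 g, O g & forall s, S s -> ~ T (g s).
Proof.
elim/finite_set_induction: S / => [_ T O _ _ [g Og]|a S IH aSX]; first by exists g.
have aX : ~ open_points a by apply: aSX; left.
have {}IH := IH (subset_trans (@subsetUr _ _ _) aSX).
(* Inner induction on the set [T2] that [a] avoids; [T1] stays quantified because the step enlarges
   the set that [S] avoids. *)
suff key T2 : finite_set T2 -> forall T1 O, finite_set T1 -> opens tau O ->
    O !=set0 -> exists g, [/\ O g, forall s, S s -> ~ T1 (g s) & ~ T2 (g a)].
  move=> T O Tf Oo O0; have [g [Og gS ga]] := key T Tf T O Tf Oo O0.
  by exists g => // s [->|]; [|exact: gS].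
move=> T2f; have bT2f := T2f; elim/finite_set_induction: T2 / T2f bT2f.
  by move=> _ T1 O T1f Oo O0; have [g Og gS] := IH T1 O T1f Oo O0; exists g; split=> // -[].
move=> b T2 IH2 bT2f T1 O T1f Oo [x0 Ox0].
have {}IH2 := IH2 (sub_finite_set (@subsetUr _ _ _) bT2f).
have [|W [O1 [Wo O1o W1 O1x0 WO1]]] := opens_mul tau_gt (x := 1) (y := x0) Oo.
  by rewrite mul1g.
have [x Ox xa] := move_point Oo (ex_intro _ x0 Ox0) aX bT2f.
have [||g' [[Og' /= Wg'] g'S g'a]] := IH2 T1 (O `&` [set g | W (x * g^-1)]) T1f.
- apply: opensI => //.
  exact: (opens_inv tau_gt (opens_mull tau_gt x Wo)).
- by exists x; split=> //=; rewrite mulgV.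
have [g'b|g'nb] := pselect (g' a = b); last by exists g'; split=> // -[].
(* The added translate of [T1] keeps [x * g'^-1 * g] from sending [S] into [T1]. *)
have [|||g [[O1g Og] gS ga]] := IH2 (T1 `|` (g' * x^-1) @` T1) (O1 `&` O).
- by rewrite finite_setU; split=> //; exact: finite_image.
- exact: opensI.
- by exists x0.
have [gb|gnb] := pselect (g a = b); last first.
  by exists g; split=> // [s Ss T1gs|[]//]; apply: (gS s Ss); left.
exists (x * g'^-1 * g); split=> [|s Ss T1s|].
- exact: WO1.
- apply: (gS s Ss); right; exists ((x * g'^-1 * g) s) => //.
  by rewrite -aut_mulE !mulgA mulgVK mulgV mul1g.
- by rewrite 2!aut_mulE gb -[in X in g'^-1 X]g'b autK.
Qed.

Lemma nbhd1_open_points U : nbhd1 tau U ->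
  exists C, [/\ finite_set C, C `<=` open_points & pstab C `<=` U].
Proof.
have half3 W : nbhd1 tau W -> exists2 V, nbhd1 tau V & [/\ V `<=` W,
    forall x, V x -> V x^-1 &
    forall x y z, V x -> V y -> V z -> W (x * y * z)].
  move=> /(nbhd1_half tau_gt)[W1 [W1n _ W1W]].
  have [V [Vn VV VW1]] := nbhd1_half tau_gt W1n.
  have V1 := nbhd1_one Vn; have VW1' x : V x -> W1 x.
    by move=> Vx; rewrite -[x]mulg1; exact: VW1.
  exists V => //; split=> // [x Vx|x y z Vx Vy Vz]; last first.
    by apply: W1W; [exact: VW1|exact: VW1'].
  by rewrite -[x]mulg1; apply: W1W; exact: VW1'.
(* Three levels of cubes: [V] puts the conjugate by [g] of the stabiliser of [A] into [V2], [V2]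
   puts [l * h * m] into [V1], and [V1] puts the whole five-term product into [U]. *)
move=> /half3[V1 V1n [_ _ V1U]]; have [V2 V2n [V21 _ V2V1]] := half3 _ V1n.
have [V [O [Oo O1 OV]] [VV2 VV V3V2]] := half3 _ V2n.
have [A Af AV] : exists2 A : set M, finite_set A & pstab A `<=` V.
  by apply: nbhd1_pstab; exists O.
have Sf : finite_set (A `\` open_points) by exact: finite_setD.
have [|g /OV Vg gA] := move_finite Sf (@subIsetr _ _ _) Af Oo; first by exists 1.
have gAf : finite_set (g @` A) by exact: finite_image.
have gAV : pstab (g @` A) `<=` V2.
  move=> k kgA; have -> : k = g * (g^-1 * k * g) * g^-1.
    by rewrite !mulgA mulgV mul1g mulgK.
  apply: V3V2 => //; last exact: VV.
  by apply: AV => a Aa; rewrite 2!aut_mulE kgA ?autK //; exists a.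
exists (A `&` g @` A); split.
- exact: finite_setIl.
- move=> c [Ac [a Aa gac]]; rewrite -gac; apply: open_points_invariant.
  by apply: contrapT => aX; apply: (gA a); rewrite ?gac.
- move=> f /(pstab_factor K_free M_lim Af gAf)[h [l [m [n [hA lB mB nB ->]]]]].
  apply: V1U; [apply: V2V1|apply: V21|apply: V21]; try exact: gAV.
    exact/VV2/AV.
  exact/VV2/VV/AV.
Qed.

(** The two topologies are compared at 1: one inclusion is [nbhd1_open_points], the other
    [pstab_nbhd1]. *)
Lemma coarser_topologyE : tau = tau_st open_points.
Proof.
apply: topology_on_eq => U; split=> [Uo g Ug|Uo].
  exact: nbhd1_open_points (nbhd1_opens tau_gt Uo Ug).
apply: (opens_nbhd1 tau_gt) => g /Uo[A [Af AX AU]].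
by apply: nbhd1_sub (pstab_nbhd1 Af AX).
Qed.

End CoarserTopology.

(** * Pullback topologies and total minimality *)

Section Pullback.
Context {G H : groupType} (sigma : topology_on H) (f : G -> H).

Definition pullback_opens : set_system G :=
  [set U | exists2 V, opens sigma V & U = f @^-1` V].

Lemma pullback_opensT : pullback_opens setT.
Proof. by exists setT => //; exact: opensT. Qed.

Lemma pullback_opensI : setI_closed pullback_opens.
Proof.
by move=> _ _ [U Uo ->] [V Vo ->]; exists (U `&` V) => //; exact: opensI.
Qed.

Lemma pullback_opens_bigcup (F : set_system G) :
  F `<=` pullback_opens -> pullback_opens (\bigcup_(U in F) U).
Proof.
(* Taking every open [V] whose preimage belongs to [F] avoids choosing one for each member. *)
move=> FO; exists (\bigcup_(V in [set V | opens sigma V /\ F (f @^-1` V)]) V).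
  by apply: opens_bigcup => V [].
apply/seteqP; split=> [x [U FU Ux]|x [V [Vo FV] Vx]]; last by exists (f @^-1` V).
by have [V Vo UV] := FO _ FU; rewrite UV in FU Ux; exists V.
Qed.

Definition pullback : topology_on G :=
  TopologyOn pullback_opensT pullback_opensI pullback_opens_bigcup.

(** The pullback cannot separate elements with the same image under [f], which is why the
    classification must cover non-Hausdorff topologies. *)
Lemma pullback_group : {morph f : x y / x * y} -> group_topology sigma ->
  group_topology pullback.
Proof.
move=> fM /group_topologyP[mulc invc]; apply/group_topologyP.
have f1 : f 1 = 1 by apply: (mulgI (f 1)); rewrite -fM !mulg1.
have fV x : f x^-1 = (f x)^-1 by apply: (mulgI (f x)); rewrite -fM !mulgV.
split=> [_ [U Uo ->] x y /=|_ [U Uo ->]].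
  rewrite fM => /(mulc U Uo)[P [Q [Po Qo Px Qy PQ]]].
  exists (f @^-1` P), (f @^-1` Q); split=> //; [by exists P|by exists Q|].
  by move=> p q /= Pp Qq; rewrite fM; exact: PQ.
exists [set y | U y^-1]; first exact: invc.
by apply/seteqP; split=> x /=; rewrite fV.
Qed.

End Pullback.

(** The basic neighbourhoods of [g] and [h] given by a point [a] consist of the automorphisms
    agreeing with them at [a]; if these always meet, then [g = h]. *)
Lemma tau_st_hausdorff (L : language) (M : structure L) :
  hausdorff_space (space (tau_st [set: M])).
Proof.
move=> g h gh; apply: aut_eq => a.
pose N (k : aut M) : set (space (tau_st [set: M])) := [set l | pstab [set a] (k^-1 * l)].
have NN k : nbhs (k : space (tau_st [set: M])) (N k).
  exists (N k); split=> //; first exact: pstab_open.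
  by move=> b _; exact: (autK k).
have [l [/(_ a erefl) gl /(_ a erefl) hl]] := gh _ _ (NN g) (NN h).
by rewrite -[in LHS]gl -[in RHS]hl !aut_mulE !autKV.
Qed.

Theorem theoremA (L : language) (K : structure L -> Prop) (M : structure L)
    (countable_L : countable [set: L])
    (K_free : free_amalgamation_class K)
    (M_lim : fraisse_limit K M) :
  (forall tau : topology_on (aut M),
     group_topology tau ->
     opens tau `<=` opens (tau_st [set: M]) ->
     exists X : set M, aut_invariant X /\ tau = tau_st X) /\
  (aut_transitive M -> totally_minimal (tau_st [set: M])).
Proof.
have coarser (tau : topology_on (aut M)) : group_topology tau ->
    opens tau `<=` opens (tau_st [set: M]) ->
    exists X : set M, aut_invariant X /\ tau = tau_st X.
  move=> tau_gt tau_coarse; exists (open_points (tau := tau)); split.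
    exact: open_points_invariant.
  exact: (coarser_topologyE K_free M_lim tau_gt tau_coarse).
split=> // M_trans; split.
- by apply: tau_st_group.
- exact: tau_st_hausdorff.
move=> H sigma f sigma_gt sigmaT fM f_surj /continuousP fc U Uo.
have [|X [X_inv tauX]] := coarser _ (pullback_group fM sigma_gt).
  by move=> _ [V Vo ->]; exact: fc.
have f_onto y : exists x, f x = y by have [x _ <-] := f_surj y I; exists x.
have [[x Xx]|X0] := pselect (X !=set0).
  have XT : X = setT.
    by apply/seteqP; split=> // y _; have [g <-] := M_trans x y; exact: X_inv.
  (* [U] is now open in the pullback, so it is a full preimage, and surjectivity makes its image the
     open set [V]. *)
  have [V Vo UV] : opens (pullback sigma f) U by rewrite tauX XT.
  rewrite UV (_ : f @` (f @^-1` V) = V) //.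
  apply/seteqP; split=> [_ [z ? <-] //|y Vy].
  by have [z zy] := f_onto y; exists z; rewrite //= zy.
(* Otherwise the pulled back topology is indiscrete, so H is trivial. *)
have full V : opens sigma V -> V !=set0 -> V = setT.
  move=> Vo [y Vy]; have [z zy] := f_onto y.
  have : opens (pullback sigma f) (f @^-1` V) by exists V.
  (* [A] lies in the empty set [X], so its pointwise stabiliser is the whole group. *)
  rewrite tauX => /(_ z); rewrite /= zy => /(_ Vy)[A [_ AX AV]].
  apply/seteqP; split=> // y' _; have [z' <-] := f_onto y'.
  rewrite -(mulVKg z z'); apply: AV => a /AX Xa; case: X0; by exists a.
have [[g Ug]|U0] := pselect (U !=set0); last first.
  rewrite (_ : f @` U = set0); first exact: open0.
  by apply/seteqP; split=> // y [g Ug _]; apply: U0; exists g.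
rewrite (_ : f @` U = setT); first exact: openT.
(* By [full], every neighbourhood of [f g] contains [y], so the Hausdorff property gives
   [f g = y]. *)
apply/seteqP; split=> // y _; exists g => //; apply: sigmaT => P Q.
move=> [P' [P'o P'g /subset_trans P'P]] [Q' [Q'o Q'y Q'Q]].
exists y; split; last exact: Q'Q.
by apply: (P'P _ (@subset_refl _ _)); rewrite (full P') //; exists (f g).
Qed.
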